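(* For every $k\in\mathbb{N}$, each of the following classes of finite graphs is quasi-isometric to a class of graphs of bounded treewidth; that is, for each class $\mathcal{G}$ in the list there exist $q,w\in\mathbb{N}$ such that every graph in $\mathcal{G}$ is $q$-quasi-isometric to some finite graph of treewidth at most $w$: (i) the class of graphs with rank-width at most $k$; (ii) the class of graphs with tree independence number at most $k$; (iii) the class of graphs with mim-width at most $k$; (iv) the class of graphs with sim-width at most $k$.
   Context: $\mathbb{N}$ is the set of positive integers. Graphs are simple, undirected, unweighted and finite. $\operatorname{dist}_G(u,v)$ is the length of a shortest path between $u$ and $v$ in $G$, and is $\infty$ if no such path exists. Quasi-isometry: for $q\in\mathbb{N}$, $G$ is $q$-quasi-isometric to $H$ if there is a map $\phi\colon V(G)\to V(H)$ such that $q^{-1}\operatorname{dist}_G(u,v)-q\le \operatorname{dist}_H(\phi(u),\phi(v))\le q\operatorname{dist}_G(u,v)+q$ for all $u,v\in V(G)$, and for every $x\in V(H)$ there is $v\in V(G)$ with $\operatorname{dist}_H(x,\phi(v))\le q$. Tree-decompositions: a tree-decomposition of $G$ is a pair $(T,\beta)$ with $T$ a tree and $\beta\colon V(T)\to 2^{V(G)}$ such that every edge of $G$ has both ends in some bag $\beta(x)$, and for every $v\in V(G)$ the set $\{x\in V(T): v\in\beta(x)\}$ induces a non-empty connected subtree of $T$. Its width is $\max_x|\beta(x)|-1$; treewidth is the minimum width of a tree-decomposition. The independence number of $(T,\beta)$ is $\max_x \alpha(G[\beta(x)])$, where $\alpha$ is the maximum size of an independent set; the tree independence number of $G$ is the minimum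 independence number of a tree-decomposition of $G$. Branch-decompositions: a branch-decomposition of $G$ is a pair $(T,L)$ where $T$ is a subcubic tree (maximum degree at most $3$) and $L$ is a bijection from $V(G)$ to the set of leaves of $T$. Each edge $e$ of $T$ gives a partition $(A_1^e,A_2^e)$ of $V(G)$, where $A_i^e$ is the set of vertices mapped to leaves in the $i$-th component of $T-e$. For a function $f\colon 2^{V(G)}\to\{0,1,2,\dots\}$ that is symmetric under complementation, the $f$-width of $(T,L)$ is the maximum of $f(A_1^e)$ over edges $e$ of $T$, and the corresponding width of $G$ is the minimum $f$-width of a branch-decomposition of $G$ (taken to be $0$ if $|V(G)|\le 1$). - Rank-width: $f(A)$ is the rank over the two-element field of the $A\times(V(G)\setminus A)$ submatrix of the adjacency matrix of $G$. - Mim-width: $f(A)$ is the maximum size of an induced matching in the bipartite graph consisting of the edges of $G$ between $A$ and $V(G)\setminus A$. - Sim-width: $f(A)$ is the maximum size $m$ of an induced matching $\{a_1b_1,\dots,a_mb_m\}$ in $G$ itself with all $a_i\in A$ and all $b_i\in V(G)\setminus A$. *)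

(* Defs.v *)
From mathcomp Require Import all_boot all_order all_algebra.
From mathcomp Require Import constructive_ereal.
Set Implicit Arguments.
Unset Strict Implicit.
Unset Printing Implicit Defensive.
Import Order.TTheory GRing.Theory Num.Theory.

Record sgraph := SGraph {
  vertex :> finType;
  adj : rel vertex;
  adj_sym : symmetric adj;
  adj_irr : irreflexive adj }.

Section Graphs.
Variable G : sgraph.
Implicit Types (u v : G) (A : {set G}).

Definition edges : {set {set G}} :=
  [set [set p.1; p.2] | p : G * G & adj p.1 p.2].

Definition degree v : nat := #|[set u | adj v u]|.

Definition has_path u v (n : nat) : bool :=
  [exists p : n.-tuple G, [&& path (@adj G) u p, uniq (u :: p) & last u p == v]].

(* The vertices of a path are distinct, so its length is less than #|G|; the
   minimum of the empty family is +oo. *)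
Definition dist u v : \bar rat :=
  \big[Order.min/+oo%E]_(n < #|G| | has_path u v n) (n%:R%:E)%E.

(* The null graph does not count as connected, so trees and the subtrees of a
   tree-decomposition are nonempty. *)
Definition connected : Prop :=
  (0 < #|G|)%N /\ forall u v, connect (@adj G) u v.

Definition acyclic : Prop :=
  forall c : seq G, (2 < size c)%N -> ~ ucycle (@adj G) c.

Definition is_tree : Prop := connected /\ acyclic.

Definition independent A : bool :=
  [forall u in A, forall v in A, ~~ adj u v].

Definition alpha : nat := \max_(A : {set G} | independent A) #|A|.

Definition induced_adj A : rel {x | x \in A} := fun x y => adj (val x) (val y).

Lemma induced_adj_sym A : symmetric (@induced_adj A).
Proof. by move=> x y; rewrite /induced_adj adj_sym. Qed.

Lemma induced_adj_irr A : irreflexive (@induced_adj A).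
Proof. by move=> x; rewrite /induced_adj adj_irr. Qed.

Definition induced A : sgraph :=
  SGraph (@induced_adj_sym A) (@induced_adj_irr A).

Definition del_edge_adj (e : {set G}) : rel G :=
  fun u v => adj u v && ([set u; v] != e).

Lemma del_edge_adj_sym e : symmetric (del_edge_adj e).
Proof. by move=> u v; rewrite /del_edge_adj adj_sym setUC. Qed.

Lemma del_edge_adj_irr e : irreflexive (del_edge_adj e).
Proof. by move=> u; rewrite /del_edge_adj adj_irr. Qed.

Definition del_edge (e : {set G}) : sgraph :=
  SGraph (del_edge_adj_sym e) (del_edge_adj_irr e).

Definition cut_adj A : rel G :=
  fun u v => adj u v && ((u \in A) != (v \in A)).

Lemma cut_adj_sym A : symmetric (cut_adj A).
Proof. by move=> u v; rewrite /cut_adj adj_sym eq_sym. Qed.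

Lemma cut_adj_irr A : irreflexive (cut_adj A).
Proof. by move=> u; rewrite /cut_adj adj_irr. Qed.

Definition cut_graph A : sgraph := SGraph (@cut_adj_sym A) (@cut_adj_irr A).

Definition induced_matching (M : {set {set G}}) : bool :=
  (M \subset edges) &&
  [forall e in M, forall f in M, (e != f) ==>
     [forall u in e, forall v in f, (u != v) && ~~ adj u v]].

End Graphs.

Definition quasi_isometric (q : nat) (G H : sgraph) : Prop :=
  exists phi : G -> H,
    (forall u v : G,
       ((q%:R^-1)%:E * dist u v - q%:R%:E <= dist (phi u) (phi v))%E /\
       (dist (phi u) (phi v) <= q%:R%:E * dist u v + q%:R%:E)%E) /\
    (forall x : H, exists v : G, (dist x (phi v) <= q%:R%:E)%E).

Definition tree_decomposition (G T : sgraph) (beta : T -> {set G}) : Prop :=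
  [/\ is_tree T,
      forall u v : G, adj u v -> exists x : T, u \in beta x /\ v \in beta x
    & forall v : G, connected (induced [set x : T | v \in beta x])].

(* Valued in int: the null graph has a decomposition of width -1. *)
Definition tree_width (G T : sgraph) (beta : T -> {set G}) : int :=
  ((\max_(x : T) #|beta x|)%N%:Z - 1)%R.

Definition tree_alpha (G T : sgraph) (beta : T -> {set G}) : nat :=
  \max_(x : T) alpha (induced (beta x)).

Definition treewidth_le (G : sgraph) (w : nat) : Prop :=
  exists (T : sgraph) (beta : T -> {set G}),
    tree_decomposition beta /\ (tree_width beta <= w%:Z)%R.

Definition tree_independence_number_le (G : sgraph) (k : nat) : Prop :=
  exists (T : sgraph) (beta : T -> {set G}),
    tree_decomposition beta /\ (tree_alpha beta <= k)%N.

Definition branch_decomposition (G T : sgraph) (L : G -> T) : Prop :=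
  [/\ is_tree T,
      forall x : T, (degree x <= 3)%N,
      injective L
    & L @: [set: G] = [set x | degree x == 1%N]].

Definition branch_side (G T : sgraph) (L : G -> T) (x y : T) : {set G} :=
  [set v | connect (@adj (del_edge [set x; y])) x (L v)].

(* Both orientations of each edge of T are inspected, i.e. both sides of its
   partition; this is harmless since f is symmetric under complementation. *)
Definition branch_width (G T : sgraph) (f : {set G} -> nat) (L : G -> T) : nat :=
  \max_(p : T * T | adj p.1 p.2) f (branch_side L p.1 p.2).

Definition width_le (G : sgraph) (f : {set G} -> nat) (k : nat) : Prop :=
  (#|G| <= 1)%N \/
  exists (T : sgraph) (L : G -> T),
    branch_decomposition L /\ (branch_width f L <= k)%N.

Definition cut_rank (G : sgraph) (A : {set G}) : nat :=
  \rank (\matrix_(i < #|A|, j < #|~: A|)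
           ((adj (enum_val i) (enum_val j))%:R : 'F_2))%R.

Definition cut_mim (G : sgraph) (A : {set G}) : nat :=
  \max_(M : {set {set G}} | @induced_matching (cut_graph A) M) #|M|.

Definition cut_sim (G : sgraph) (A : {set G}) : nat :=
  \max_(M : {set {set G}} | @induced_matching G M &&
                            (M \subset edges (cut_graph A))) #|M|.

Definition rank_width_le (G : sgraph) (k : nat) : Prop := width_le (@cut_rank G) k.
Definition mim_width_le (G : sgraph) (k : nat) : Prop := width_le (@cut_mim G) k.
Definition sim_width_le (G : sgraph) (k : nat) : Prop := width_le (@cut_sim G) k.

Definition qi_to_bounded_treewidth (C : sgraph -> Prop) : Prop :=
  exists q w : nat,
    [/\ (0 < q)%N, (0 < w)%N
      & forall G : sgraph, C G ->
          exists H : sgraph, quasi_isometric q G H /\ treewidth_le H w].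

(* Main.v *)
Require Import Defs.
From mathcomp Require Import all_boot all_order all_algebra.
From mathcomp Require Import constructive_ereal zify.
Set Implicit Arguments.
Unset Strict Implicit.
Unset Printing Implicit Defensive.
Import Order.TTheory GRing.Theory Num.Theory.

(** An induced matching of G across a cut that is maximal has its 2k ends within
    distance 2 of every vertex incident with the cut. Hence a branch-decomposition
    of sim-width k gives a tree-decomposition, on the same tree, each of whose
    bags is covered by boundedly many balls of bounded radius r; so does
    a tree-decomposition with small independence number, a maximal independent
    set of a bag being dominating. As sim-width is at most mim-width and
    rank-width, everything reduces to this: if each bag of a tree-decomposition
    (T, beta) of G has a set C of at most c centres whose r-balls cover it, then
    V(G) has a partition into parts of bounded weak diameter whose quotient
    has bounded treewidth.

    Root T and traverse it from the top, maintaining at most c live clusters,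
    each with a centre and a level l <= 2c, of radius r + sigma * l. At a node t
    the points of C(t) are offered as new clusters of level 0, each p in C(t)
    chooses the offered cluster maximizing tau * level - dist(centre, p) for some
    tau slightly below sigma, and clusters chosen by no p are discarded.
    A chosen cluster moves up one level if some discarded cluster had at least its
    level. Then a discarded cluster reaches, beyond the bag of t, nowhere
    farther than the surviving cluster chosen near the point of passage. Levels
    stay bounded because a move from level j - 1 to j discards a cluster of level
    at least j - 1, which keeps at most 2c - j clusters at level at least j.
    A vertex is assigned to the highest cluster in T that contains it; the
    clusters live at t or at its parent form the bag of t in a tree-decomposition
    of the quotient. *)

(** * Distances *)

Section Within.
Variable G : sgraph.
Implicit Types (u v w : G) (m n N : nat).

(** Distances are handled through this decidable relation on [nat]; the extended values of [dist]
    enter only in the passage to [quasi_isometric]. *)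
Fixpoint within n u v : bool :=
  (u == v) || (if n is m.+1 then [exists w, adj u w && within m w v] else false).

Lemma withinS n u w v : adj u w -> within n w v -> within n.+1 u v.
Proof. by move=> uw wv; apply/orP; right; apply/existsP; exists w; rewrite uw. Qed.

Lemma within_refl n u : within n u u.
Proof. by case: n => [|n] /=; rewrite eqxx. Qed.

Lemma within_case n u v : within n.+1 u v ->
  u = v \/ exists2 w, adj u w & within n w v.
Proof.
case/orP => [/eqP->|/existsP[w /andP[uw wv]]]; [by left|].
by right; exists w.
Qed.

Lemma within0 u v : within 0 u v -> u = v.
Proof. by rewrite /= orbF => /eqP. Qed.

Lemma within_mono m n u v : m <= n -> within m u v -> within n u v.
Proof.
elim: m n u => [|m IHm] [|n] u // mn; first by move/within0->; apply: within_refl.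
case/within_case=> [->|[w uw wv]]; first exact: within_refl.
by apply: withinS uw (IHm _ _ _ wv).
Qed.

Lemma within_trans m n u v w : within m u v -> within n v w -> within (m + n) u w.
Proof.
elim: m u => [|m IHm] u; first by move/within0->.
case/within_case=> [->|[x ux xv] vw]; last by apply: withinS ux (IHm _ xv vw).
exact: within_mono (leq_addl _ _).
Qed.

Lemma within_adj u v : adj u v -> within 1 u v.
Proof. by move=> uv; apply: withinS uv (within_refl _ _). Qed.

Lemma within_sym n u v : within n u v = within n v u.
Proof.
suff sub u' v' : within n u' v' -> within n v' u' by apply/idP/idP; apply: sub.
elim: n u' => [|n IHn] u'; first by move/within0->; exact: within_refl.
case/within_case=> [->|[w uw /IHn wv]]; first exact: within_refl.
by rewrite -addn1; apply: within_trans wv (within_adj _); rewrite adj_sym.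
Qed.

Lemma within_path u p : path (@adj G) u p -> within (size p) u (last u p).
Proof.
elim: p u => [|v p IHp] u; first by rewrite within_refl.
by move=> /andP[uv vp]; apply: withinS uv (IHp _ vp).
Qed.

Lemma within_ex_path n u v : within n u v ->
  exists p, [/\ path (@adj G) u p, last u p = v & size p <= n].
Proof.
elim: n u => [|n IHn] u; first by move/within0->; exists [::].
case/within_case=> [->|[w uw /IHn[p [wp pv pn]]]]; first by exists [::].
by exists (w :: p); rewrite /= uw.
Qed.

Lemma connect_within u v : connect (@adj G) u v -> exists n, within n u v.
Proof. by case/connectP=> p up ->; exists (size p); apply: within_path. Qed.

Variant dist_spec u v : \bar rat -> Prop :=
| DistFin n of within n u v & (forall m, within m u v -> n <= m) :
    dist_spec u v (n%:R%:E)%E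
| DistInf of (forall m, ~~ within m u v) : dist_spec u v +oo%E.

(** A walk shortens to a path without repeated vertices, which has length below [#|G|] and so takes
    part in the minimum defining [dist]. *)
Lemma dist_le_within n u v : within n u v -> (dist u v <= n%:R%:E)%E.
Proof.
case/within_ex_path=> p [up pv pn].
move: pv; case: (shortenP up) => q uq quniq qp qv.
have qn : size q <= n.
  by apply: leq_trans pn; apply: uniq_leq_size => //; case/andP: quniq.
have qG : size q < #|G|.
  by have := uniq_leq_size quniq (fun x _ => mem_enum G x); rewrite -cardE.
rewrite /dist (le_trans (y := (size q)%:R%:E)%E) //; last first.
  by rewrite lee_fin ler_nat.
apply: (@bigmin_le_cond _ _ _ _ (Ordinal qG)).
apply/existsP; exists (in_tuple q); rewrite uq quniq; exact/eqP.
Qed.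

Lemma distP u v : dist_spec u v (dist u v).
Proof.
have : (dist u v = +oo%E) \/ exists2 n, dist u v = (n%:R%:E)%E & within n u v.
  rewrite /dist; elim/big_ind: _ => [|x y hx hy|n /existsP[p /and3P[up _ /eqP<-]]].
  - by left.
  - by rewrite minEle; case: ifP.
  by right; exists n; rewrite // -[X in within X](size_tuple p) within_path.
case=> [duv|[n duv uv]].
- rewrite duv; constructor => m; apply/negP => /dist_le_within.
  by rewrite duv.
rewrite duv; constructor => // m /dist_le_within.
by rewrite duv lee_fin ler_nat.
Qed.

(** The distance truncated at [N], the value that [find] returns when no [n < N] works. Truncation
    keeps the triangle inequality, and a value below [N] still comes from a walk. *)
Definition cdist N u v : nat := find (fun n => within n u v) (iota 0 N).

Lemma cdist_le_cap N u v : cdist N u v <= N.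
Proof. by rewrite -[X in _ <= X](size_iota 0 N) find_size. Qed.

Lemma cdist_le N n u v : within n u v -> cdist N u v <= n.
Proof.
move=> uv; rewrite leqNgt; apply/negP => lt_n.
have nN : n < N := leq_trans lt_n (cdist_le_cap _ _ _).
by have := before_find 0 lt_n; rewrite nth_iota // uv.
Qed.

Lemma cdist_within N u v : cdist N u v < N -> within (cdist N u v) u v.
Proof.
move=> lt_N; have : has (fun n => within n u v) (iota 0 N).
  by rewrite has_find size_iota.
by move/(nth_find 0); rewrite -/(cdist N u v) nth_iota.
Qed.

Lemma cdist_sym N u v : cdist N u v = cdist N v u.
Proof. by apply: eq_find => n; rewrite within_sym. Qed.

Lemma cdist_triangle N u v w : cdist N u w <= cdist N u v + cdist N v w.
Proof.
have [uv|uv] := ltnP (cdist N u v) N; last first.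
  exact: leq_trans (cdist_le_cap _ _ _) (leq_trans uv (leq_addr _ _)).
have [vw|vw] := ltnP (cdist N v w) N; last first.
  exact: leq_trans (cdist_le_cap _ _ _) (leq_trans vw (leq_addl _ _)).
exact: cdist_le (within_trans (cdist_within uv) (cdist_within vw)).
Qed.

Lemma cdist_refl N u : cdist N u u = 0.
Proof. by apply/eqP; rewrite -leqn0; apply/cdist_le/within_refl. Qed.

End Within.

Local Open Scope ring_scope.
(** The term [q * q] is the additive error [q] of the lower bound after multiplication by [q]. *)
Lemma quasi_isometric_within (q : nat) (G H : sgraph) (phi : G -> H) :
  (0 < q)%N -> (forall x, exists v, phi v = x) ->
  (forall n u v, within n u v -> within n (phi u) (phi v)) ->
  (forall n u v, within n (phi u) (phi v) -> within (q * n + q * q) u v) ->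
  quasi_isometric q G H.
Proof.
move=> q_gt0 phi_surj phi_hom phi_inv; exists phi; split; last first.
  move=> x; have [v <-] := phi_surj x; exists v.
  by apply: dist_le_within; apply: within_refl.
have q0 : (0 : rat) < q%:R by rewrite ltr0n.
move=> u v; split.
- case: (distP (phi u) (phi v)) => [n uvn _|_]; last by rewrite leey.
  case: (distP u v) => [m uvm mmin|/(_ (q * n + q * q)%N)]; last first.
    by rewrite (phi_inv _ _ _ uvn).
  rewrite -EFinM -EFinB lee_fin lerBlDr ler_pdivrMl //.
  by rewrite mulrDr -!natrM -natrD ler_nat mmin // phi_inv.
case: (distP u v) => [m uvm mmin|_]; last first.
  by rewrite mulry gtr0_sg // mul1e /= leey.
apply: le_trans (dist_le_within (phi_hom _ _ _ uvm)) _.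
rewrite -EFinM -EFinD lee_fin -natrM -natrD ler_nat.
by rewrite (leq_trans _ (leq_addr _ _)) // leq_pmull.
Qed.
Local Close Scope ring_scope.

(** * Rooted trees *)

(** A simple path joining [x] to [y] without their edge has at least three vertices, and the edge
    closes it to a cycle. *)
Lemma acyclic_bridge (T : sgraph) (x y : T) : acyclic T -> adj x y ->
  ~~ connect (@adj (del_edge [set x; y])) x y.
Proof.
move=> acT xy; apply/negP => /connectP[p0 xp0 y_last].
move: y_last; case: (shortenP xp0) => p xp p_uniq _ y_last.
have pT : path (@adj T) x p.
  by apply: sub_path xp => u v /andP[].
case: p xp p_uniq y_last pT => [|z [|z' p]] xp p_uniq y_last pT.
- by rewrite y_last /= adj_irr in xy.
- by move: xp; rewrite /= /del_edge_adj y_last eqxx !andbF.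
apply: (acT (x :: z :: z' :: p)) => //; apply/andP; split => //.
by rewrite /cycle rcons_path pT /= -[last _ _]/(last x (z :: z' :: p)) -y_last adj_sym.
Qed.

Definition rooted (T : sgraph) (root : T) (par : T -> T) (dep : T -> nat) : Prop :=
  [/\ par root = root, dep root = 0,
      forall t, t != root -> adj t (par t) /\ dep t = (dep (par t)).+1
    & forall x y, adj x y -> y = par x /\ x != root \/ x = par y /\ y != root].

(** Here [dep] is the distance to the root and [par] picks a neighbour one step closer. *)
Lemma tree_rooted (T : sgraph) : is_tree T ->
  exists (root : T) (par : T -> T) (dep : T -> nat), rooted root par dep.
Proof.
case=> -[/card_gt0P[root _] connT] acT.
have ex t : exists n, within n t root by apply/connect_within/connT.
pose dep t := ex_minn (ex t).
have dep_within t : within (dep t) t root by rewrite /dep; case: ex_minnP.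
have dep_min t n : within n t root -> dep t <= n.
  by rewrite /dep; case: ex_minnP => m _ h /h.
pose par t := if t == root then root else
  odflt root [pick w | adj t w && within (dep t).-1 w root].
have par_root : par root = root by rewrite /par eqxx.
have par_step t : t != root -> adj t (par t) /\ dep t = (dep (par t)).+1.
  move=> tr; rewrite /par (negbTE tr); case: pickP => [w /andP[tw wr]|none] /=.
    split=> //; apply/eqP; rewrite eqn_leq dep_min ?(withinS tw) //=.
    rewrite -[X in _ < X]prednK; first by rewrite ltnS dep_min.
    rewrite lt0n; apply: contra tr => /eqP d0.
    by have := dep_within t; rewrite d0 => /within0->.
  case dt: (dep t) (dep_within t) => [|n] /=; first by rewrite orbF (negbTE tr).
  rewrite (negbTE tr) => /existsP[w].
  by have := none w; rewrite dt /= => ->.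
exists root, par, dep; split=> //.
  by apply/eqP; rewrite -leqn0 dep_min ?within_refl.
move=> x y xy.
have [/andP[/eqP-> ->]|/negP yx] := boolP ((y == par x) && (x != root)); first by left.
have [/andP[/eqP-> ->]|/negP xy'] := boolP ((x == par y) && (y != root)); first by right.
(* If [xy] is no parent edge, climbing from [x] and from [y] to the root avoids it, against
   [acyclic_bridge]. *)
have to_root z : connect (@adj (del_edge [set x; y])) z root.
  have [n] := ubnP (dep z); elim: n z => // n IHn z dz.
  have [->|zr] := eqVneq z root; first exact: connect0.
  have [zp dzp] := par_step z zr.
  apply: connect_trans (connect1 _) (IHn (par z) _); last by rewrite dzp in dz.
  rewrite /= /del_edge_adj zp /=; apply/negP => /eqP eq_e.
  have := set21 z (par z); rewrite eq_e => /set2P[] zE; subst z.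
    have := set22 x y; rewrite -eq_e => /set2P[] yE.
      by rewrite yE adj_irr in xy.
    by apply: yx; rewrite yE eqxx.
  have := set21 x y; rewrite -eq_e => /set2P[] xE.
    by rewrite xE adj_irr in xy.
  by apply: xy'; rewrite -xE eqxx.
have := acyclic_bridge acT xy; rewrite (connect_trans (to_root x)) //.
have /sym_connect_sym -> : symmetric (@adj (del_edge [set x; y])) by apply: adj_sym.
exact: to_root.
Qed.

Section RootedTree.
Variables (T : sgraph) (root : T) (par : T -> T) (dep : T -> nat).
Hypothesis rT : rooted root par dep.
Implicit Types s t x y : T.

Definition anc s t : bool := fconnect par t s.

Lemma anc_refl t : anc t t. Proof. exact: connect0. Qed.

Lemma anc_par t : anc (par t) t. Proof. exact: fconnect1. Qed.

Lemma anc_trans x y z : anc x y -> anc y z -> anc x z.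
Proof. by move=> xy yz; apply: connect_trans yz xy. Qed.

Lemma rooted_ind (P : T -> Prop) :
  (forall t, (t != root -> P (par t)) -> P t) -> forall t, P t.
Proof.
case: rT => _ _ dpar _ step t.
have [n] := ubnP (dep t); elim: n t => // n IHn t dt.
by apply: step => /dpar[_ dE]; apply: IHn; rewrite dE in dt.
Qed.

Lemma anc_dep s t : anc s t -> s = t \/ dep s < dep t.
Proof.
case: rT => [par_root _ stp _] /iter_findex <-.
elim: findex => [|n IHn] /=; first by left.
set u := iter n par t in IHn *.
have [ur|ur] := eqVneq u root; first by rewrite ur par_root -ur.
have [_ du] := stp _ ur.
by right; case: IHn => [<-|]; rewrite du // => /ltnW.
Qed.

Lemma anc_dep_le s t : anc s t -> dep s <= dep t.
Proof. by case/anc_dep=> [->|/ltnW]. Qed.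

Lemma anc_anti s t : anc s t -> anc t s -> s = t.
Proof. by case/anc_dep=> // st /anc_dep_le; rewrite leqNgt st. Qed.

Lemma anc_proper s t : anc s t -> s != t -> t != root /\ anc s (par t).
Proof.
case: rT => [par_root _ _ _] /iter_findex <-.
case: findex => [|n]; first by rewrite /= eqxx.
have [->|tr _] := eqVneq t root; last first.
  by split=> //; rewrite iterSr; apply: fconnect_iter.
by rewrite (_ : iter _ _ _ = root) ?eqxx //; elim: n.+1 => //= k ->.
Qed.

Lemma anc_total s s' t : anc s t -> anc s' t -> anc s s' || anc s' s.
Proof.
move=> /iter_findex <- /iter_findex <-.
move: (findex _ _ s) (findex _ _ s') => m n.
have [mn|/ltnW nm] := leqP m n; [rewrite -(subnK mn) | rewrite -(subnK nm)];
  by rewrite iterD /anc fconnect_iter ?orbT.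
Qed.

Lemma par_not_anc s : s != root -> ~~ anc s (par s).
Proof.
case: rT => [_ _ stp _] /stp[_ ds]; apply/negP => /anc_dep_le.
by rewrite ds ltnn.
Qed.

(* The edge from s to its parent is the only one leaving the set of
   descendants of s. *)
Lemma anc_cross s x y : adj x y -> ~~ anc s x -> anc s y ->
  [/\ y = s, x = par s & s != root].
Proof.
case: rT => [_ _ _ edge] xy sx sy; case: (edge x y xy) => -[eqp nr].
  by case/negP: sx; apply: anc_trans sy _; rewrite eqp; apply: anc_par.
have [sE|ns] := eqVneq s y; first by split; rewrite ?sE.
by case/negP: sx; rewrite eqp; have [] := anc_proper sy ns.
Qed.

(** A walk inside [S] from [t1] to [t2] must enter the descendants of [s], and [anc_cross] leaves
    only one edge for this. *)
Lemma subtree_cross (S : {set T}) s t1 t2 : connected (induced S) ->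
  t1 \in S -> t2 \in S -> ~~ anc s t1 -> anc s t2 ->
  [/\ s \in S, par s \in S & s != root].
Proof.
move=> [_ connS] t1S t2S.
pose t1' : induced S := exist _ t1 t1S; pose t2' : induced S := exist _ t2 t2S.
rewrite -[t1]/(val t1') -[t2]/(val t2').
have /connectP[p] := connS t1' t2'.
move: t1' t2' => x y {t1S t2S connS} xp ->.
elim: p x xp => [|z p IHp] x /=; first by move=> _ /negbTE->.
case/andP=> xz zp sx sy.
have [sz|sz] := boolP (anc s (val z)); last exact: IHp zp sz sy.
have [zE xE sr] := anc_cross xz sx sz.
by split=> //; [rewrite -zE | rewrite -xE]; apply: valP.
Qed.

(** * Vertices and walks in a rooted tree-decomposition *)

Section Decomposition.
Variables (G : sgraph) (beta : T -> {set G}).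
Hypothesis tdG : tree_decomposition beta.
Implicit Types (u v w b : G).

(** The default [root] never occurs, since every vertex lies in some bag. *)
Definition top v : T :=
  if [pick t | v \in beta t] is Some t0
  then [arg min_(t < t0 | v \in beta t) dep t] else root.

Lemma mem_top v : v \in beta (top v).
Proof.
case: tdG => _ _ /(_ v)[/card_gt0P[x _] _].
rewrite /top; case: pickP => [t0 t0v|/(_ (val x))]; first by case: arg_minnP.
by have := valP x; rewrite inE => ->.
Qed.

(** Otherwise the subtree of [v] would leave the descendants of [top v] through its parent, a node
    of smaller depth. *)
Lemma top_anc v t : v \in beta t -> anc (top v) t.
Proof.
move=> vt; apply/negPn/negP => ntop.
case: tdG => _ _ /(_ v) conv.
have [] := subtree_cross conv (t1 := t) (t2 := top v) _ _ ntop (anc_refl _);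
  rewrite ?inE ?mem_top // => _ pS tr.
case: rT => [_ _ /(_ _ tr)[_ dE] _].
suff : dep (top v) <= dep (par (top v)) by rewrite dE ltnn.
move: pS; rewrite {1 2 3}/top; case: pickP => [t0 t0v|/(_ t)]; last by rewrite vt.
by case: arg_minnP => // s _ smin; apply: smin.
Qed.

(** Each edge of the walk lies in a bag. When these bags first move below [s], the current vertex
    has bags on both sides, hence lies in [beta s] by [subtree_cross]. *)
Lemma within_cross n s t1 t2 u v : within n u v ->
  u \in beta t1 -> v \in beta t2 -> ~~ anc s t1 -> anc s t2 ->
  exists w n1 n2, [/\ w \in beta s, within n1 u w, within n2 w v & n1 + n2 <= n].
Proof.
case: tdG => _ edge conv.
elim: n u t1 => [|n IHn] u t1.
  move=> /within0-> vt1 vt2 s1 s2.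
  have [] := subtree_cross (conv v) (t1 := t1) (t2 := t2) _ _ s1 s2; rewrite ?inE //.
  by move=> vs _ _; exists v, 0, 0; rewrite vs within_refl.
move=> uv ut1 vt2 s1 s2; case/within_case: uv => [uv|[x ux xv]]; first subst v.
  have [] := subtree_cross (conv u) (t1 := t1) (t2 := t2) _ _ s1 s2; rewrite ?inE //.
  by move=> vs _ _; exists u, 0, 0; rewrite vs within_refl.
have [t [ut xt]] := edge _ _ ux.
have [st|st] := boolP (anc s t).
  have [] := subtree_cross (conv u) (t1 := t1) (t2 := t) _ _ s1 st; rewrite ?inE //.
  move=> us _ _; exists u, 0, n.+1; rewrite us within_refl; split=> //.
  exact: withinS ux xv.
have [w [n1 [n2 [ws xw wv le_n]]]] := IHn x t xv xt vt2 st s2.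
by exists w, n1.+1, n2; split=> //; apply: withinS ux xw.
Qed.

End Decomposition.
End RootedTree.

(** * Updating the live clusters *)

Section Step.
Variables (V : finType) (d : V -> V -> nat) (c r : nat).

Let K := 2 * c.
Let mu := (2 * r).+1.

Definition cluster := (V * 'I_(2 * c).+1)%type.
Implicit Types (L : {set cluster}) (C : {set V}) (a g : cluster) (p : V).

(* With these weights, a cluster chosen at p over another one reaches at least
   mu farther beyond p when its level is the higher one, and falls short by at
   most mu * K otherwise, which a move up by one level turns into mu ahead. *)
Definition radius (l : nat) : nat := r + mu * K.+1 * l.

Definition cost g p : nat := d g.1 p + mu * K * (K - g.2).

(** At [j = K] this says that no cluster has the top level, so that a move up stays within
    ['I_(2 * c).+1]. *)
Definition level_bounded L : Prop :=
  forall j, #|[set g in L | j <= g.2]| <= K - j.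

Definition offered C L : {set cluster} := L :|: [set (p, ord0) | p in C].

(** Minimizing [cost] maximizes tau * level - distance for tau = [mu * K], whereas [radius] grows by
    sigma = [mu * K.+1] per level. The default [(p, ord0)] is itself offered when [p \in C]. *)
Definition best C L p : cluster := [arg min_(g < (p, ord0) in offered C L) cost g p].

Definition kept C L : {set cluster} := best C L @: C.

Definition beaten C L g : bool := [exists a in offered C L :\: kept C L, g.2 <= a.2].

Definition bump C L g : cluster := if beaten C L g then (g.1, inord g.2.+1) else g.

Definition step C L : {set cluster} := bump C L @: kept C L.

Lemma bestP C L p : p \in C ->
  best C L p \in offered C L /\
  forall a, a \in offered C L -> cost (best C L p) p <= cost a p.
Proof.
move=> pC; rewrite /best; case: arg_minnP => //.
by rewrite inE imset_f ?orbT.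
Qed.

Lemma kept_sub C L : kept C L \subset offered C L.
Proof. by apply/subsetP=> _ /imsetP[p pC ->]; case: (bestP L pC). Qed.

Lemma card_step C L : #|step C L| <= #|C|.
Proof. exact: leq_trans (leq_imset_card _ _) (leq_imset_card _ _). Qed.

(** New clusters have level 0 and count only at [j = 0], where the total is at most [c + c = K]. *)
Lemma offered_bounded C L : #|C| <= c -> #|L| <= c -> level_bounded L ->
  level_bounded (offered C L).
Proof.
move=> Cc Lc Lb [|j].
  rewrite subn0; apply: (@leq_trans #|offered C L|); last first.
    apply: leq_trans (leq_card_setU L [set (p, ord0) | p in C]) _.
    apply: (@leq_trans (c + c)); last by rewrite /K; lia.
    by rewrite leq_add // (leq_trans (leq_imset_card _ _)).
  apply: subset_leq_card.
  by apply/subsetP=> g; rewrite inE => /andP[].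
apply: leq_trans (Lb j.+1); apply: subset_leq_card; apply/subsetP => g.
by rewrite !inE => /andP[/orP[-> ->//|/imsetP[p _ ->]]].
Qed.

Lemma bump_level C L g : level_bounded (offered C L) -> g \in kept C L ->
  beaten C L g -> (bump C L g).2 = g.2.+1 :> nat.
Proof.
move=> Lb gk bg; rewrite /bump bg /= inordK // ltnS ltnNge; apply/negP => Kg.
case/existsP: bg => a /andP[/setDP[aL ak] ga].
have := Lb K; rewrite subnn leqn0 cards_eq0 => /eqP/setP/(_ a).
by rewrite !inE (leq_trans Kg ga) andbT -in_setU aL.
Qed.

(* A cluster is bumped from level j - 1 to j only if some cluster of level at
   least j - 1 is discarded, so the count at level j does not overflow. *)
Lemma step_bounded C L : #|C| <= c -> #|L| <= c -> level_bounded L ->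
  level_bounded (step C L).
Proof.
move=> Cc Lc Lb0; have Lb := offered_bounded Cc Lc Lb0 => j.
have sub_im : [set g in step C L | j <= g.2] \subset
    bump C L @: [set g in kept C L | j <= (bump C L g).2].
  apply/subsetP=> g; rewrite inE => /andP[/imsetP[h hk ->] jh].
  by apply: imset_f; rewrite inE hk.
apply: leq_trans (subset_leq_card sub_im) _.
apply: leq_trans (leq_imset_card _ _) _.
have [/existsP[g /and3P[gk bg /eqP gj]]|none] :=
  boolP [exists g, [&& g \in kept C L, beaten C L g & g.2.+1 == j]].
  case/existsP: bg => a /andP[/setDP[aL ak] ga].
  have := Lb j.-1; rewrite (cardsD1 a) inE aL -gj /= ga => Lb1.
  set Y := [set g in kept C L | _]; set X := _ :\ a in Lb1.
  suff YX : #|Y| <= #|X|.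
    by have := leq_ltn_trans YX Lb1; rewrite /= subnS; case: (K - g.2).
  apply/subset_leq_card/subsetP=> h; rewrite !inE -in_setU => /andP[hk lh].
  rewrite -/(offered C L) (subsetP (kept_sub C L)) //=.
  apply/andP; split; first by apply: contraNneq ak => <-.
  case bh: (beaten C L h); first by rewrite bump_level in lh.
  by rewrite /bump bh in lh; apply: ltnW.
(* No kept cluster moves to level exactly [j], so those now at level at least [j] were there
   before. *)
apply: leq_trans (subset_leq_card _) (Lb j); apply/subsetP=> g.
rewrite !inE -in_setU => /andP[gk]; rewrite -/(offered C L) (subsetP (kept_sub C L)) //=.
case bg: (beaten C L g); last by rewrite /bump bg.
rewrite bump_level // leq_eqVlt => /orP[/eqP gj|//].
by case/existsP: none; exists g; rewrite gk bg -gj eqxx.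
Qed.

(** Beyond [p], [g] reaches at least [mu] farther than [a]. If [a] was moved up, its new version
    serves. If it was discarded, take the cluster chosen at [p]: with levels [lg] and [la],
    minimality of [cost] bounds [d g.1 p - d a.1 p] by [mu * K * (lg - la)]. *)
Lemma step_dominates C L a p : #|C| <= c -> #|L| <= c -> level_bounded L ->
  a \in offered C L -> a \notin step C L -> p \in C ->
  exists2 g, g \in step C L & d g.1 p + radius a.2 + mu <= radius g.2 + d a.1 p.
Proof.
move=> Cc Lc Lb0 aL astep pC; have Lb := offered_bounded Cc Lc Lb0.
have step_bump g : g \in kept C L -> bump C L g \in step C L.
  by move=> gk; apply: imset_f.
have bump1 g : (bump C L g).1 = g.1 by rewrite /bump; case: ifP.
have aK := ltn_ord a.2.
have [ak|ak] := boolP (a \in kept C L).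
  exists (bump C L a); first exact: step_bump.
  have ba : beaten C L a.
    apply: contraNT astep => nb.
    by have := step_bump _ ak; rewrite /bump (negbTE nb).
  by rewrite bump1 bump_level // /radius; nia.
have [gL gmin] := bestP L pC; set g := best C L p in gL gmin.
have gk : g \in kept C L by apply: imset_f.
exists (bump C L g); first exact: step_bump.
have gK := ltn_ord g.2.
have := gmin a aL; rewrite /cost bump1 /radius.
case: (leqP g.2 a.2) => ga.
  (* The move up adds [mu * K.+1] to the radius, which suffices because [la - lg <= K]. *)
  have bg : beaten C L g by apply/existsP; exists a; rewrite inE ak aL.
  rewrite bump_level // -/K in aK gK *.
  move: (d g.1 p) (d a.1 p) => x y.
  have := (mulnBr (mu * K) K g.2, mulnBr (mu * K) K a.2).
  nia.
(* Now [lg - la >= 1], and each level is worth [mu] more in [radius] than in [cost]. *)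
have lev : g.2 <= (bump C L g).2.
  case bg: (beaten C L g); first by rewrite bump_level.
  by rewrite /bump bg.
rewrite -/K in aK gK *.
have [l ll] : exists l : nat, l = (bump C L g).2 by exists (bump C L g).2.
rewrite -ll in lev *; clear ll.
move: (d g.1 p) (d a.1 p) => x y.
move: (nat_of_ord g.2) (nat_of_ord a.2) lev ga gK aK => lg la lev ga gK aK.
move: K mu lev gK aK => K0 mu0 lev gK aK.
rewrite !mulnBr -!(mulnA mu0 K0.+1) !mulSn !mulnDr !mulnA.
have gA : mu0 * K0 * lg <= mu0 * K0 * K0 by rewrite leq_mul2l -ltnS gK orbT.
have aA : mu0 * K0 * la <= mu0 * K0 * K0 by rewrite leq_mul2l -ltnS aK orbT.
have lA : mu0 * K0 * lg <= mu0 * K0 * l by rewrite leq_mul2l lev orbT.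
have lmu : mu0 * la.+1 <= mu0 * l by rewrite leq_mul2l (leq_trans ga lev) orbT.
rewrite mulnS in lmu; move: lmu lA gA aA.
move: (mu0 * K0 * K0) (mu0 * K0 * lg) (mu0 * K0 * la) (mu0 * K0 * l).
move: (mu0 * la) (mu0 * l).
lia.
Qed.

(** Apply domination to the cluster offered at [p] itself. The slack [r] lets the surviving cluster
    reach every vertex within [r] of [p]. *)
Lemma step_covers C L p : #|C| <= c -> #|L| <= c -> level_bounded L -> p \in C ->
  exists2 g, g \in step C L & d g.1 p + r <= radius g.2 + d p p.
Proof.
move=> Cc Lc Lb pC; have pL : (p, ord0) \in offered C L.
  by rewrite inE imset_f ?orbT.
have [pS|pS] := boolP ((p, ord0) \in step C L).
  by exists (p, ord0); rewrite // /radius /= muln0 addn0 addnC.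
have [g gS le_g] := step_dominates Cc Lc Lb pL pS pC.
by exists g => //; move: le_g; rewrite /radius /= muln0; lia.
Qed.

Lemma step_center C L g : g \in step C L ->
  g.1 \in C \/ exists2 a, a \in L & a.1 = g.1.
Proof.
case/imsetP=> h /(subsetP (kept_sub C L)) hL ->.
have -> : (bump C L h).1 = h.1 by rewrite /bump; case: ifP.
move: hL; rewrite inE => /orP[hL|/imsetP[p pC ->]]; last by left.
by right; exists h.
Qed.

End Step.

(** * Tree-decompositions with bags covered by few balls *)

Section Quotient.
Variables (G : sgraph) (F : finType) (f : G -> F).

Definition quotient_adj : rel F := fun x y =>
  (x != y) && [exists u, exists v, [&& adj u v, f u == x & f v == y]].

Lemma quotient_adj_sym : symmetric quotient_adj.
Proof.
suff sub x y : quotient_adj x y -> quotient_adj y x.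
  by move=> x y; apply/idP/idP; apply: sub.
case/andP=> xy /existsP[u /existsP[v /and3P[uv fu fv]]].
rewrite /quotient_adj eq_sym xy; apply/existsP; exists v; apply/existsP; exists u.
by rewrite adj_sym uv fu fv.
Qed.

Lemma quotient_adj_irr : irreflexive quotient_adj.
Proof. by move=> x; rewrite /quotient_adj eqxx. Qed.

(** Only attained values are kept as vertices, which makes [quotient_map] surjective. *)
Definition quotient : sgraph :=
  @induced (SGraph quotient_adj_sym quotient_adj_irr) (f @: [set: G]).

Definition quotient_map (v : G) : quotient := exist _ (f v) (imset_f f (in_setT v)).

Lemma quotient_map_surj (x : quotient) : exists v, quotient_map v = x.
Proof.
by case: x => y yf; have /imsetP[v _ yE] := yf; exists v; apply: val_inj; rewrite /= yE.
Qed.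

(** Lifting a quotient edge costs one edge of [G] and a move of length at most [D] inside a part;
    one more such move ends the walk. *)
Lemma quotient_quasi_isometric D : (forall u v, f u = f v -> within D u v) ->
  quasi_isometric D.+1 G quotient.
Proof.
move=> small; apply: (@quasi_isometric_within _ _ _ quotient_map) => //.
- exact: quotient_map_surj.
- elim=> [|n IHn] u v; first by move/within0->; apply: within_refl.
  case/within_case=> [->|[w uw /IHn wv]]; first exact: within_refl.
  have [fE|fN] := eqVneq (f u) (f w).
    apply: within_mono (leqnSn n) _; suff -> : quotient_map u = quotient_map w by [].
    exact: val_inj.
  apply: withinS wv; rewrite /= /induced_adj /= /quotient_adj fN.
  by apply/existsP; exists u; apply/existsP; exists w; rewrite uw !eqxx.
move=> n u v uv; have: within (D.+1 * n + D) u v.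
  elim: n u uv => [|n IHn] u; first by move/within0 => [/small]; rewrite muln0.
  case/within_case=> [[/small]|[x]].
    by apply: within_mono; apply: leq_addl.
  case/andP=> _ /existsP[u' /existsP[w /and3P[uw /eqP fu /eqP fw]]].
  have -> : x = quotient_map w by apply: val_inj.
  move=> /IHn wv; have uu : within D u u' by apply: small; rewrite fu.
  have := within_trans (within_trans uu (within_adj uw)) wv.
  by apply: within_mono; rewrite mulnS; lia.
by apply: within_mono; lia.
Qed.

End Quotient.

(** * Live clusters along the tree and the resulting partition *)

Section Core.
Variables (G T : sgraph) (beta : T -> {set G}).
Variables (root : T) (par : T -> T) (dep : T -> nat).
Hypothesis rT : rooted root par dep.
Hypothesis tdG : tree_decomposition beta.
Variables (c r : nat) (C : T -> {set G}).
Hypothesis C_sub : forall t, C t \subset beta t.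
Hypothesis C_card : forall t, #|C t| <= c.
Hypothesis C_cover : forall t v, v \in beta t -> exists2 p, p \in C t & within r p v.
Implicit Types (s t : T) (u v w : G) (g : cluster G c).

Let R := radius c r (2 * c).
(** Values up to [R.+1] must be genuine distances: a radius, at most [R], plus one edge in
    [part_persists]. *)
Let d := @cdist G R.+2.

Fixpoint live_rec n t : {set cluster G c} :=
  step d r (C t) (if n is m.+1 then live_rec m (par t) else set0).

Definition live t := live_rec (dep t) t.

Definition inherited t := if t == root then set0 else live (par t).

Lemma liveE t : live t = step d r (C t) (inherited t).
Proof.
case: rT => _ dep0 dpar _; rewrite /live /inherited.
have [->|tr] := eqVneq t root; first by rewrite dep0.
by have [_ ->] := dpar t tr.
Qed.

Lemma inherited_bounded t : #|inherited t| <= c /\ level_bounded (inherited t).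
Proof.
elim/(rooted_ind rT): t => t IHt; rewrite /inherited.
case: eqVneq IHt => [_ _|tr /(_ isT)[Ic Ib]].
  by rewrite cards0; split=> // j; rewrite (_ : [set _ in _ | _] = set0) ?cards0 //;
     apply/setP=> g; rewrite !inE.
rewrite liveE; split; last exact: step_bounded.
exact: leq_trans (card_step _ _ _ _) _.
Qed.

Lemma card_live t : #|live t| <= c.
Proof. by rewrite liveE (leq_trans (card_step _ _ _ _)). Qed.

Lemma live_center t g : g \in live t -> exists2 s, anc par s t & g.1 \in beta s.
Proof.
elim/(rooted_ind rT): t g => t IHt g; rewrite liveE => /step_center[gC|[a]].
  by exists t; [apply: anc_refl | apply: (subsetP (C_sub t))].
rewrite /inherited; case: eqVneq IHt => [_ _|_ /(_ isT) IHt]; first by rewrite inE.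
move=> /IHt[s st ags] <-; exists s => //.
exact: anc_trans st (anc_par _ _).
Qed.

Lemma radius_le g : radius c r g.2 <= R.
Proof. by rewrite leq_add2l leq_mul2l -ltnS ltn_ord orbT. Qed.

Definition captured s v : bool := [exists g in live s, d g.1 v <= radius c r g.2].

Lemma captured_self t v : v \in beta t -> captured t v.
Proof.
case/C_cover=> p pC pv; have [Ic Ib] := inherited_bounded t.
have [g gL le_g] := step_covers d r (C_card t) Ic Ib pC.
apply/existsP; exists g; rewrite liveE gL /=.
have := cdist_triangle R.+2 g.1 p v; have := cdist_le R.+2 pv.
move: le_g; rewrite /d cdist_refl.
move: (cdist _ _ _) (cdist _ p v) (cdist _ _ _) (radius _ _ _); lia.
Qed.

Let top := top root dep beta.

(** Only ancestors of [top v] compete, so the homes of two vertices sharing a bag are comparable. *)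
Definition home v : T :=
  [arg min_(s < top v | anc par s (top v) && captured s v) dep s].

Lemma homeP v : [/\ anc par (home v) (top v), captured (home v) v &
  forall s, anc par s (top v) -> captured s v -> dep (home v) <= dep s].
Proof.
rewrite /home; case: arg_minnP.
  by rewrite anc_refl captured_self // (mem_top _ _ tdG).
by move=> s /andP[-> ->] smin; split=> // s' s1 s2; apply: smin; rewrite s1.
Qed.

Definition capturer v : cluster G c :=
  odflt (v, ord0) [pick g in live (home v) | d g.1 v <= radius c r g.2].

Lemma capturerP v : capturer v \in live (home v) /\
  d (capturer v).1 v <= radius c r (capturer v).2.
Proof.
rewrite /capturer; case: pickP => [g /andP[]//|none].
by case: (homeP v) => _ /existsP[g]; rewrite none.
Qed.

Fixpoint birth_rec n t g : T :=
  if n is m.+1 then if g \in live (par t) then birth_rec m (par t) g else t else t.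

Definition birth t g := birth_rec (dep t) t g.

Lemma birthE t g :
  birth t g = if (t != root) && (g \in live (par t)) then birth (par t) g else t.
Proof.
case: rT => _ dep0 dpar _; rewrite /birth.
have [->|tr] := eqVneq t root; first by rewrite dep0.
by have [_ ->] := dpar t tr.
Qed.

(** The same centre and level may be live in separate regions of [T]; the node tells these lifetimes
    apart, as [birth] does in [active]. *)
Definition part v : T * cluster G c := (home v, capturer v).

Definition active t : {set T * cluster G c} := [set (birth t g, g) | g in live t].

Lemma card_active t : #|active t| <= c.
Proof. exact: leq_trans (leq_imset_card _ _) (card_live t). Qed.

(** The home is the birth node of the capturer: were the capturer live at the parent, the parent
    would capture [v] too, against the choice of [home]. *)
Lemma part_active v : part v \in active (home v).
Proof.
have [cap_live cap_d] := capturerP v.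
apply/imsetP; exists (capturer v) => //; rewrite birthE /part.
case: andP => // -[hr cap_par]; case: rT => _ _ /(_ _ hr)[_ dh] _.
have [h_top _ /(_ (par (home v)))] := homeP v.
rewrite dh ltnn => /(_ (anc_trans (anc_par _ _) h_top)); case/(_ _)/notF.
by apply/existsP; exists (capturer v); rewrite cap_par.
Qed.

Lemma part_small u v : part u = part v -> within (2 * R) u v.
Proof.
case=> _ cE; have [_ du] := capturerP u; have [_ dv] := capturerP v.
rewrite -cE in dv; have := radius_le (capturer u); set g := capturer u in du dv *.
move=> gR; have close w : d g.1 w <= radius c r g.2 -> within R g.1 w.
  move=> dw; apply: within_mono (leq_trans dw gR) _; apply: cdist_within.
  by rewrite ltnS (leq_trans dw) // (leq_trans gR).
by rewrite mul2n -addnn; apply: within_trans (close v dv); rewrite within_sym close.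
Qed.

(* If the cluster of a were discarded at a node t strictly above the home of b,
   then t would already have captured b: a shortest walk from the centre to b
   passes through the bag of t, where some live cluster dominates. *)
Lemma part_persists a b t : adj a b -> anc par (home a) t ->
  anc par t (home b) -> t != home b -> part a \in active t.
Proof.
move=> ab; elim/(rooted_ind rT): t => t IHt at_ tb tNb.
have [<-|atN] := eqVneq (home a) t; first exact: part_active.
have [tr ap] := anc_proper rT at_ atN.
have pt := anc_par par t.
have := IHt tr ap (anc_trans pt tb).
case: eqVneq => [pE|_ /(_ isT)].
  by move: (anc_anti rT tb); rewrite -pE => /(_ pt) tE; rewrite tE pE eqxx in tNb.
case/imsetP=> g gp [hE gE].
suff gt : g \in live t.
  by apply/imsetP; exists g; rewrite // [birth t g]birthE tr gp -hE -gE.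
apply/negPn/negP => gt; have [Ic Ib] := inherited_bounded t.
have [s sp gs] := live_center gp.
have [hb_top _ hb_min] := homeP b.
have [_ da] := capturerP a; rewrite gE in da.
have db : d g.1 b <= radius c r g.2 + 1.
  apply: leq_trans (cdist_triangle _ _ a _) _.
  by rewrite leq_add // cdist_le // within_adj // adj_sym.
have walk : within (d g.1 b) g.1 b.
  apply: cdist_within; rewrite ltnS (leq_trans db) // addn1 ltnS; exact: radius_le.
have st : ~~ anc par t s.
  by apply: contra (par_not_anc rT tr) => ts; apply: anc_trans ts sp.
have t_top : anc par t (top b) := anc_trans tb hb_top.
have [w [n1 [n2 [wt gw wb le_n]]]] :=
  within_cross rT tdG walk gs (mem_top root dep tdG b) st t_top.
have [p pC pw] := C_cover wt.
have gO : g \in offered (C t) (inherited t) by rewrite inE /inherited (negbTE tr) gp.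
rewrite liveE in gt.
have [h hL le_h] := step_dominates (d := d) (r := r) (C_card t) Ic Ib gO gt pC.
have : dep (home b) <= dep t.
  apply: hb_min => //; apply/existsP; exists h; rewrite liveE hL /=.
  have gpw : d g.1 p <= n1 + r.
    apply: leq_trans (cdist_triangle _ _ w _) (leq_add (cdist_le _ gw) _).
    by rewrite cdist_sym cdist_le.
  have hpw : d h.1 b <= d h.1 p + (r + n2).
    apply: leq_trans (cdist_triangle _ _ p _) _; rewrite leq_add2l.
    exact: leq_trans (cdist_triangle _ _ w _) (leq_add (cdist_le _ pw) (cdist_le _ wb)).
  (* The detours through [p] cost [r] twice and the edge [ab] costs 1; together this is the margin
     [mu], that is [(2 * r).+1], gained in [le_h]. *)
  apply: leq_trans hpw _; have n12 := leq_trans le_n db.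
  move: (d h.1 p) (d g.1 p) (radius c r g.2) (radius c r h.2) le_h gpw n12.
  by clear; lia.
case: (anc_dep rT tb) => [tE|]; first by rewrite tE eqxx in tNb.
by rewrite ltnNge => /negbTE->.
Qed.

(** The parent is included because [part_persists] keeps a part active only strictly above the home
    of the neighbour. *)
Definition part_bag t : {set T * cluster G c} := active t :|: active (par t).

Lemma active_up t h : h \in active t -> t != h.1 -> h \in active (par t).
Proof.
case/imsetP=> g gt -> /=; rewrite [birth t g]birthE.
by case: andP => [[_ gp] _|]; [apply/imsetP; exists g | rewrite eqxx].
Qed.

Lemma active_root h : h \in active root -> h.1 = root.
Proof. by case/imsetP=> g _ ->; rewrite birthE eqxx. Qed.

Lemma active_birth t h : h \in active t -> h \in active h.1.
Proof.
elim/(rooted_ind rT): t h => t IHt h ht.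
have [<-//|tN] := eqVneq t h.1; have hp := active_up ht tN.
have [tr|tr] := eqVneq t root; last exact: IHt hp.
by case/imsetP: ht tN => g _ -> /=; rewrite birthE tr eqxx /= eqxx.
Qed.

(** At any node of the set other than [h.1], [h] is active at the parent, so every node climbs to
    [h.1] inside the set. *)
Lemma part_bag_connected h : (exists t, h \in active t) ->
  connected (induced [set t | h \in part_bag t]).
Proof.
case=> t0 /active_birth hh; set S := [set t | _].
have hS : h.1 \in S by rewrite !inE hh.
have to_home t (tS : t \in S) :
    connect (@adj (induced S)) (exist _ t tS) (exist _ h.1 hS).
  elim/(rooted_ind rT): t tS => t IHt tS.
  have [tE|tN] := eqVneq t h.1.
    by rewrite (_ : exist _ t tS = exist _ h.1 hS) //; apply: val_inj.
  have hp : h \in active (par t).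
    by have := tS; rewrite !inE => /orP[/active_up->|].
  have [tr|tr] := eqVneq t root.
    have [par_root _ _ _] := rT; rewrite tr par_root in hp; have hr := active_root hp.
    by rewrite hr tr eqxx in tN.
  have pS : par t \in S by rewrite !inE hp.
  apply: connect_trans (connect1 _) (IHt tr pS).
  by case: rT => _ _ /(_ t tr)[].
split; first by apply/card_gt0P; exists (exist _ h.1 hS).
move=> x y; case: x y => [x xS] [y yS]; apply: connect_trans (to_home x xS) _.
by rewrite (sym_connect_sym (@adj_sym (induced S))).
Qed.

(** The homes are comparable, both being ancestors of a common bag. The lower one serves: the other
    part is active there or at its parent. *)
Lemma part_edge_bag u v : adj u v ->
  exists t, part u \in part_bag t /\ part v \in part_bag t.
Proof.
wlog uv_dep : u v / anc par (home u) (home v).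
  move=> H uv; have [_ edge _] := tdG; have [t [ut vt]] := edge u v uv.
  have ha x : x \in beta t -> anc par (home x) t.
    by move=> xt; have [h1 _ _] := homeP x; apply: anc_trans h1 (top_anc rT tdG xt).
  case/orP: (anc_total (ha u ut) (ha v vt)) => huv; first exact: H.
  by have [|s [sv su]] := H v u huv; [rewrite adj_sym | exists s].
move=> uv; exists (home v); rewrite !inE part_active; split=> //.
have [<-|hN] := eqVneq (home u) (home v); first by rewrite part_active.
have [vr up] := anc_proper rT uv_dep hN.
rewrite (@part_persists u v (par (home v))) ?orbT //; first exact: anc_par.
by apply: contraNneq (par_not_anc rT vr) => pE; rewrite pE anc_refl.
Qed.

Definition quotient_bag t : {set quotient part} := [set x | val x \in part_bag t].

Lemma quotient_decomposition : tree_decomposition quotient_bag.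
Proof.
split; first by case: tdG.
- move=> x y /andP[_ /existsP[u /existsP[v /and3P[uv /eqP fu /eqP fv]]]].
  have [t [ut vt]] := part_edge_bag uv; exists t.
  by rewrite !inE -fu -fv in ut vt *.
move=> x; have [v vx] := quotient_map_surj x.
rewrite (_ : [set t | _] = [set t | val x \in part_bag t]); last first.
  by apply/setP=> t; rewrite [LHS]inE [LHS]inE [RHS]inE.
by apply: part_bag_connected; exists (home v); rewrite -vx part_active.
Qed.

Lemma card_quotient_bag t : #|quotient_bag t| <= 2 * c.
Proof.
apply: (@leq_trans #|part_bag t|).
  rewrite -(card_imset _ val_inj); apply/subset_leq_card/subsetP=> _ /imsetP[x xt ->].
  by rewrite inE in xt.
apply: leq_trans (leq_card_setU _ _) _.
apply: (@leq_trans (c + c)); last by rewrite addnn mul2n.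
by rewrite leq_add ?card_active.
Qed.

End Core.

Lemma coarse_treewidth c r : exists q, 0 < q /\
  forall (G T : sgraph) (beta : T -> {set G}), tree_decomposition beta ->
  (forall t, exists C : {set G}, [/\ C \subset beta t, #|C| <= c &
     forall v, v \in beta t -> exists2 p, p \in C & within r p v]) ->
  exists H, quasi_isometric q G H /\ treewidth_le H (2 * c).
Proof.
exists (2 * radius c r (2 * c)).+1; split=> // G T beta tdG covers.
have [treeT _ _] := tdG; have [root [par [dep rT]]] := tree_rooted treeT.
(* A boolean form of the hypothesis, so that [xchoose] selects the centres of all bags. *)
pose good t (C : {set G}) := [&& C \subset beta t, #|C| <= c &
  [forall v in beta t, [exists p in C, within r p v]]].
have good_ex t : exists C, good t C.
  have [C [C1 C2 C3]] := covers t; exists C; rewrite /good C1 C2 /=.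
  by apply/forall_inP => v /C3[p pC pv]; apply/exists_inP; exists p.
pose C t := xchoose (good_ex t).
have goodC t : good t (C t) by apply: xchooseP.
have C_sub t : C t \subset beta t by case/and3P: (goodC t).
have C_card t : #|C t| <= c by case/and3P: (goodC t).
have C_cover t v : v \in beta t -> exists2 p, p \in C t & within r p v.
  by case/and3P: (goodC t) => _ _ /forall_inP h /h /exists_inP.
exists (quotient (part beta root par dep c r C)); split.
  apply: quotient_quasi_isometric; exact: part_small.
exists T, (@quotient_bag G T beta root par dep c r C).
split; first exact: quotient_decomposition.
rewrite /tree_width; set m := \max_(_ | _) _.
have : m <= 2 * c by apply/bigmax_leqP => t _; apply: card_quotient_bag.
lia.
Qed.

(** * Applications *)

Lemma card_independent_induced (G : sgraph) (B A : {set G}) :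
  A \subset B -> independent A -> #|A| <= alpha (induced B).
Proof.
move=> AB indA; pose A' := [set x : induced B | val x \in A].
have -> : A = val @: A'.
  apply/setP=> v; apply/idP/imsetP => [vA|[x xA ->]]; last by rewrite inE in xA.
  by exists (exist _ v (subsetP AB v vA)); rewrite ?inE.
rewrite (card_imset _ val_inj); apply: leq_bigmax_cond.
apply/forall_inP=> x; rewrite inE => xA; apply/forall_inP=> y; rewrite inE => yA.
by move/forall_inP: indA => /(_ _ xA)/forall_inP/(_ _ yA).
Qed.

(** Take a maximum independent subset of [B]: a vertex neither in it nor adjacent to it could be
    added. *)
Lemma alpha_dominating (G : sgraph) (B : {set G}) :
  exists C : {set G}, [/\ C \subset B, #|C| <= alpha (induced B) &
    forall v, v \in B -> exists2 p, p \in C & within 1 p v].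
Proof.
pose P (A : {set G}) := (A \subset B) && independent A.
have ind0 : P set0.
  by rewrite /P sub0set; apply/forall_inP=> x; rewrite inE.
case: (arg_maxnP (P := P) (fun A : {set G} => #|A|) ind0) => C /andP[CB indC] Cmax.
exists C; split=> // [|v vB]; first exact: card_independent_induced.
have [/exists_inP//|far] := boolP [exists p in C, within 1 p v].
have vfar p : p \in C -> (p != v) && ~~ adj p v.
  move=> pC; move: far; rewrite negb_exists_in => /forall_inP/(_ p pC) far.
  apply/andP; split; apply: contra far; first by move=> /eqP->; apply: within_refl.
  exact: within_adj.
have /Cmax : P (v |: C).
  rewrite /P subUset sub1set vB CB /=; move/forall_inP: indC => indC.
  apply/forall_inP=> x; rewrite !inE => /orP[/eqP->|xC]; apply/forall_inP=> y;
    rewrite !inE => /orP[/eqP->|yC].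
  - by rewrite adj_irr.
  - by rewrite adj_sym; case/andP: (vfar y yC).
  - by case/andP: (vfar x xC).
  by move/forall_inP: (indC x xC) => /(_ y yC).
have vC : v \notin C by apply: contraL isT => /vfar; rewrite eqxx.
by rewrite /geq /= cardsU1 vC add1n ltnn.
Qed.

Lemma edgesP (G : sgraph) (e : {set G}) :
  reflect (exists x y, adj x y /\ e = [set x; y]) (e \in edges G).
Proof.
apply: (iffP imsetP) => [[[x y]]|[x [y [xy ->]]]]; last by exists (x, y); rewrite ?inE.
by rewrite inE /= => xy ->; exists x, y.
Qed.

(** * Maximum induced matchings across a cut *)

Section CutMatching.
Variables (G : sgraph) (A : {set G}).

Definition sim_matching (M : {set {set G}}) : bool :=
  @induced_matching G M && (M \subset edges (cut_graph A)).

Lemma cut_edgesP (e : {set G}) :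
  reflect (exists x y, [/\ adj x y, x \in A, y \notin A & e = [set x; y]])
          (e \in edges (cut_graph A)).
Proof.
apply: (iffP (@edgesP (cut_graph A) e)) => [[x [y [/andP[xy]]]]|[x [y [xy xA yA ->]]]].
  have [xA|xA] := boolP (x \in A); have [yA|yA] := boolP (y \in A) => // _ ->.
    by exists x, y.
  by exists y, x; rewrite adj_sym xy setUC.
by exists x, y; split=> //; rewrite /= /cut_adj xy xA (negbTE yA).
Qed.

Lemma cut_edges_sub : {subset edges (cut_graph A) <= edges G}.
Proof. by move=> e /cut_edgesP[x [y [xy _ _ ->]]]; apply/edgesP; exists x, y. Qed.

Lemma sim_matching0 : sim_matching set0.
Proof.
rewrite /sim_matching /induced_matching !sub0set andbT /=.
by apply/forall_inP=> e; rewrite inE.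
Qed.

Definition cut_matching : {set {set G}} := [arg max_(M > set0 | sim_matching M) #|M|].

Definition cut_cover : {set G} := cover cut_matching.

Lemma cut_matchingP : sim_matching cut_matching /\
  forall M, sim_matching M -> #|M| <= #|cut_matching|.
Proof. by rewrite /cut_matching; case: arg_maxnP; first exact: sim_matching0. Qed.

Lemma card_cut_cover : #|cut_cover| <= 2 * cut_sim A.
Proof.
have [simM _] := cut_matchingP; have /andP[_ /subsetP Mcut] := simM.
apply: leq_trans (leq_card_cover _) _.
apply: (@leq_trans (\sum_(e in cut_matching) 2)).
  apply: leq_sum => e /Mcut/cut_edgesP[x [y [_ _ _ ->]]].
  by rewrite cards2; case: (_ != _).
rewrite sum_nat_const mulnC leq_mul2l /=.
exact: (leq_bigmax_cond (P := sim_matching)).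
Qed.

Lemma cut_cover_boundary x : x \in cut_cover ->
  exists2 y, adj x y & (x \in A) != (y \in A).
Proof.
have [/andP[_ /subsetP Mcut] _] := cut_matchingP.
case/bigcupP=> e /Mcut/cut_edgesP[a [b [ab aA bA ->]]] /set2P[] ->.
  by exists b; rewrite // aA (negbTE bA).
by exists a; rewrite 1?adj_sym // aA (negbTE bA).
Qed.

(** Otherwise [vu] could join the matching: both its ends are within 1 of [v], so a matched vertex
    equal or adjacent to one of them would be within 2 of [v]. *)
Lemma cut_cover_near v u : adj v u -> (v \in A) != (u \in A) ->
  exists2 x, x \in cut_cover & within 2 x v.
Proof.
move=> vu vuA; have [/exists_inP//|far] := boolP [exists x in cut_cover, within 2 x v].
have {}far x : x \in cut_cover -> ~~ within 2 x v.
  by move: far; rewrite negb_exists_in => /forall_inP; apply.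
have [/andP[/andP[ME /forall_inP Mind] Mcut] Mmax] := cut_matchingP.
pose e := [set v; u].
have near x y : x \in e -> y \in cut_cover -> (x != y) && ~~ adj x y.
  move=> xe /far yfar.
  have xv : within 1 x v.
    case/set2P: xe => ->; first exact: within_refl.
    by apply: within_adj; rewrite adj_sym.
  apply/andP; split; apply: contra yfar.
    by move/eqP <-; apply: within_mono xv.
  move=> xy; rewrite -[2]/(1 + 1); apply: within_trans xv.
  by apply: within_adj; rewrite adj_sym.
have eM : e \notin cut_matching.
  apply/negP=> eM; have vc : v \in cut_cover by apply/bigcupP; exists e; rewrite ?set21.
  by have := near v v (set21 _ _) vc; rewrite eqxx.
have ecut : e \in edges (cut_graph A).
  apply/(@edgesP (cut_graph A)); exists v, u; split=> //.
  by rewrite /= /cut_adj vu vuA.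
have /Mmax : sim_matching (e |: cut_matching).
  rewrite /sim_matching /induced_matching !subUset !sub1set ME Mcut ecut.
  rewrite (cut_edges_sub ecut) /= andbT.
  apply/forall_inP=> e1 /setU1P[->|e1M]; apply/forall_inP=> e2 /setU1P[->|e2M].
  - by rewrite eqxx.
  - apply/implyP=> _; apply/forall_inP=> x xe; apply/forall_inP=> y ye.
    by apply: near => //; apply/bigcupP; exists e2.
  - apply/implyP=> _; apply/forall_inP=> x xe; apply/forall_inP=> y ye.
    by rewrite eq_sym adj_sym; apply: near => //; apply/bigcupP; exists e1.
  by move/forall_inP: (Mind _ e1M); apply.
by rewrite cardsU1 eM add1n ltnn.
Qed.

Lemma cut_sim_mim : cut_sim A <= cut_mim A.
Proof.
apply/bigmax_leqP=> M /andP[/andP[_ /forall_inP Mind] Mcut].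
apply: (leq_bigmax_cond (P := @induced_matching (cut_graph A))).
rewrite /induced_matching Mcut /=; apply/forall_inP=> e eM; apply/forall_inP=> f fM.
apply/implyP=> ef; apply/forall_inP=> x xe; apply/forall_inP=> y yf.
have := Mind e eM => /forall_inP/(_ f fM)/implyP/(_ ef)/forall_inP/(_ x xe).
move/forall_inP/(_ y yf) => /andP[-> xy] /=.
by rewrite /cut_adj (negbTE xy).
Qed.

(** The ends of the matching in [A] and outside [A] select rows and columns that form an identity
    submatrix. *)
Lemma cut_sim_rank : cut_sim A <= cut_rank A.
Proof.
apply/bigmax_leqP=> M /andP[/andP[_ /forall_inP Mind] /subsetP Mcut].
have ends (i : 'I_#|M|) : exists p : 'I_#|A| * 'I_#|~: A|,
    enum_val i == [set enum_val p.1; enum_val p.2].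
  have /Mcut/cut_edgesP[x [y [_ xA yA ->]]] := enum_valP i.
  have yA' : y \in ~: A by rewrite inE.
  by exists (enum_rank_in xA x, enum_rank_in yA' y); rewrite /= !enum_rankK_in.
pose f i := (xchoose (ends i)).1; pose g i := (xchoose (ends i)).2.
have fgE i : enum_val i = [set enum_val (f i); enum_val (g i)].
  by apply/eqP/(xchooseP (ends i)).
rewrite /cut_rank; set X := (\matrix_(_, _) _)%R.
suff fgX : mxsub f g X = (1%:M)%R.
  rewrite -[#|M|](mxrank1 'F_2) -fgX; apply: (@leq_trans (\rank (colsub g X))).
    suff -> : mxsub f g X = rowsub f (colsub g X) by apply/mxrankS/rowsub_sub.
    by apply/matrixP=> i j; rewrite !mxE.
  by rewrite -[X in colsub g X]mulmx1 -mulmx_colsub mxrankM_maxl.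
apply/matrixP=> i j.
rewrite !mxE; have [<-|ij] := eqVneq i j.
  have /Mcut/cut_edgesP[x [y [xy xA yA eE]]] := enum_valP i.
  have fA := enum_valP (f i); have := enum_valP (g i); rewrite inE => gA.
  have : enum_val (f i) \in [set x; y] by rewrite -eE fgE set21.
  have : enum_val (g i) \in [set x; y] by rewrite -eE fgE set22.
  case/set2P=> gE; first by rewrite gE xA in gA.
  case/set2P=> fE; last by rewrite fE (negbTE yA) in fA.
  by rewrite gE fE xy.
have := Mind _ (enum_valP i) => /forall_inP/(_ _ (enum_valP j))/implyP.
rewrite (inj_eq enum_val_inj) => /(_ ij)/forall_inP/(_ (enum_val (f i))).
rewrite {1}fgE set21 => /(_ isT)/forall_inP/(_ (enum_val (g j))).
by rewrite {1}fgE set22 => /(_ isT)/andP[_ /negbTE->].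
Qed.

End CutMatching.

(** * From branch-decompositions to tree-decompositions *)

Lemma path_avoid (T : sgraph) (x y : T) a q : path (@adj T) a q ->
  y \notin a :: q -> path (@adj (del_edge [set x; y])) a q.
Proof.
elim: q a => //= z q IHq a /andP[az zq]; rewrite !inE !negb_or => /and3P[ya yz yq].
rewrite IHq ?inE ?negb_or ?yz // andbT /del_edge_adj az /=; apply/negP => /eqP eE.
by have := set22 x y; rewrite -eE => /set2P[] yE; rewrite yE eqxx in ya yz.
Qed.

Lemma path_connect_induced (T : sgraph) (S : {set T}) a q
    (aS : a \in S) (bS : last a q \in S) :
  path (@adj T) a q -> {subset q <= S} ->
  connect (@adj (induced S)) (exist _ a aS) (exist _ (last a q) bS).
Proof.
elim: q a aS bS => [|z q IHq] a aS bS /=.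
  by move=> _ _; rewrite (bool_irrelevance aS bS).
case/andP=> az zq sub; have zS : z \in S by apply: sub; rewrite mem_head.
apply: connect_trans (connect1 _) (IHq z zS bS zq _) => //.
by move=> w wq; apply: sub; rewrite inE wq orbT.
Qed.

Section BranchTree.
Variables (G T : sgraph) (L : G -> T).
Hypothesis treeT : is_tree T.
Implicit Types (u v : G) (t x y : T).

Definition separates x y v u : bool :=
  (v \in branch_side L x y) != (u \in branch_side L x y).

Lemma del_edge_connect_sym (e : {set T}) : connect_sym (@adj (del_edge e)).
Proof. by apply: sym_connect_sym; apply: adj_sym. Qed.

(** The two pieces of the path avoid its edge from [last (L v) p1] to [y], which is a bridge, so
    [L v] and [L u] lie on different sides. *)
Lemma simple_path_separates v u p1 y p2 :
  path (@adj T) (L v) (p1 ++ y :: p2) -> uniq (L v :: p1 ++ y :: p2) ->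
  last y p2 = L u ->
  separates (last (L v) p1) y v u && separates y (last (L v) p1) v u.
Proof.
set x := last (L v) p1; rewrite cat_path -cat_cons cat_uniq.
case/and3P=> vp1 xy yp2 /and3P[_ disj _] lastE.
have [_ acT] := treeT.
have yN : y \notin L v :: p1.
  by apply: contra disj => yp; apply/hasP; exists y; rewrite ?mem_head.
have xN : x \notin y :: p2.
  by apply: contra disj => xp; apply/hasP; exists x => //; apply: mem_last.
have cx : connect (@adj (del_edge [set x; y])) x (L v).
  rewrite del_edge_connect_sym; apply/connectP; exists p1 => //.
  exact: path_avoid yN.
have cy : connect (@adj (del_edge [set x; y])) y (L u).
  apply/connectP; exists p2 => //; rewrite setUC; exact: path_avoid xN.
have bridge := acyclic_bridge acT xy.
have ncx : ~~ connect (@adj (del_edge [set x; y])) x (L u).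
  apply: contra bridge => xu; apply: connect_trans xu _.
  by rewrite del_edge_connect_sym.
have ncy : ~~ connect (@adj (del_edge [set x; y])) y (L v).
  apply: contra bridge => yv; apply: connect_trans cx _.
  by rewrite del_edge_connect_sym.
by rewrite /separates !inE cx (negbTE ncx) [[set y; x]]setUC cy (negbTE ncy).
Qed.

Lemma simple_path v u : exists p,
  [/\ path (@adj T) (L v) p, uniq (L v :: p) & last (L v) p = L u].
Proof.
have [[_ conT] _] := treeT; have /connectP[p0 vp0 ->] := conT (L v) (L u).
by case: (shortenP vp0) => p vp p_uniq _; exists p.
Qed.

(** Thus the nodes whose bags contain [v] are [L v] and those on the tree paths from [L v] to the
    leaves of the neighbours of [v]. *)
Definition branch_bag t : {set G} :=
  [set v | (L v == t) ||
     [exists y, adj t y && [exists u, adj v u && separates t y v u]]].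

Lemma leaf_branch_bag v : v \in branch_bag (L v).
Proof. by rewrite inE eqxx. Qed.

Lemma separated_branch_bag t y v u :
  adj t y -> adj v u -> separates t y v u -> v \in branch_bag t.
Proof.
move=> ty vu sep; rewrite inE; apply/orP; right; apply/existsP; exists y.
by rewrite ty; apply/existsP; exists u; rewrite vu.
Qed.

Lemma edge_branch_bag u v : adj u v ->
  exists t, u \in branch_bag t /\ v \in branch_bag t.
Proof.
move=> uv; exists (L v); rewrite leaf_branch_bag; split=> //.
have [p [vp p_uniq lastE]] := simple_path v u.
case: p vp p_uniq lastE => [|y p] vp p_uniq lastE.
  by rewrite inE -[L v]/(last (L v) [::]) lastE eqxx.
have /andP[sep _] := simple_path_separates (p1 := [::]) vp p_uniq lastE.
case/andP: vp => xy _; apply: separated_branch_bag xy uv _.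
by rewrite /separates eq_sym.
Qed.

Lemma path_branch_bag v u p : adj v u -> path (@adj T) (L v) p ->
  uniq (L v :: p) -> last (L v) p = L u -> {subset p <= [set t | v \in branch_bag t]}.
Proof.
move=> vu vp p_uniq lastE t tp; rewrite 1?inE.
case/splitPr: tp vp p_uniq lastE => p1 p2 vp p_uniq; rewrite last_cat /= => lastE.
have /andP[_] := simple_path_separates vp p_uniq lastE.
by apply: separated_branch_bag vu; move: vp; rewrite cat_path adj_sym => /and3P[].
Qed.

Lemma branch_decomposition_tree : tree_decomposition branch_bag.
Proof.
split=> //; first exact: edge_branch_bag.
move=> v; set S := [set t | _].
have vS : L v \in S by rewrite inE leaf_branch_bag.
have from_leaf t (tS : t \in S) :
    connect (@adj (induced S)) (exist _ (L v) vS) (exist _ t tS).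
  have := tS; rewrite 2!inE.
  case/orP=> [/eqP vt|/existsP[y /andP[ty /existsP[u /andP[vu sep]]]]].
    by rewrite (_ : exist _ t tS = exist _ (L v) vS) //; apply: val_inj.
  have [p [vp p_uniq lastE]] := simple_path v u.
  have sub := path_branch_bag vu vp p_uniq lastE.
  (* A path missing [t] also misses the edge [ty], which then could not separate [v] from [u]. *)
  have tp : t \in L v :: p.
    apply: contraNT sep => tp.
    have vu_con : connect (@adj (del_edge [set t; y])) (L v) (L u).
      by apply/connectP; exists p => //; rewrite setUC; apply: path_avoid tp.
    by rewrite /separates !inE -(same_connect_r (@del_edge_connect_sym _) vu_con) eqxx.
  have [q [vq qS tE]] : exists q,
      [/\ path (@adj T) (L v) q, {subset q <= S} & last (L v) q = t].
    case/splitPl: tp vp sub {p_uniq lastE} => p1 p2 p1E.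
    rewrite cat_path => /andP[vp1 _] sub.
    by exists p1; split=> // z zp; apply: sub; rewrite mem_cat zp.
  subst t; exact: path_connect_induced.
split; first by apply/card_gt0P; exists (exist _ (L v) vS).
move=> [x xS] [y yS]; apply: connect_trans (from_leaf y yS).
by rewrite (sym_connect_sym (@adj_sym (induced S))).
Qed.

Hypothesis degT : forall t, degree t <= 3.
Hypothesis L_inj : injective L.
Variable k : nat.
Hypothesis widthL : branch_width (@cut_sim G) L <= k.

(** At most three edges meet at [t], each contributing at most [2 * k] matched vertices; the extra
    one is the vertex placed at [t], if any. *)
Lemma branch_bag_cover t : exists C : {set G}, [/\ C \subset branch_bag t,
  #|C| <= (6 * k).+1
  & forall v, v \in branch_bag t -> exists2 p, p \in C & within 2 p v].
Proof.
pose D y := cut_cover (branch_side L t y).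
exists ([set v | L v == t] :|: \bigcup_(y in [set y | adj t y]) D y); split.
- apply/subsetP=> v; rewrite in_setU => /orP[|/bigcupP[y]].
    by rewrite inE => /eqP <-; apply: leaf_branch_bag.
  rewrite inE => ty /cut_cover_boundary[u vu sep].
  exact: separated_branch_bag ty vu sep.
- apply: leq_trans (leq_card_setU _ _) _; rewrite -add1n leq_add //.
    apply/card_le1_eqP=> x y; rewrite !inE => /eqP xt /eqP yt.
    by apply: L_inj; rewrite xt yt.
  apply: (@leq_trans (\sum_(y in [set y | adj t y]) #|D y|)).
    by apply: (big_ind2 (fun (B : {set G}) n => #|B| <= n)) => [|B1 n1 B2 n2 h1 h2|//];
      rewrite ?cards0 // (leq_trans (leq_card_setU _ _)) // leq_add.
  apply: (@leq_trans (\sum_(y in [set y | adj t y]) 2 * k)).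
    apply: leq_sum => y; rewrite inE => ty.
    apply: leq_trans (card_cut_cover _) _; rewrite leq_mul2l /=.
    apply: leq_trans widthL.
    exact: (@leq_bigmax_cond _ (fun p : T * T => adj p.1 p.2)
      (fun p => cut_sim (branch_side L p.1 p.2)) (t, y)).
  rewrite sum_nat_const (leq_trans (leq_mul (degT t) (leqnn _))) //.
  by rewrite mulnA.
move=> v; rewrite inE => /orP[vt|/existsP[y /andP[ty /existsP[u /andP[vu sep]]]]].
  by exists v; rewrite ?within_refl // !inE vt.
have [x xD xv] := cut_cover_near vu sep; exists x => //.
by rewrite in_setU; apply/orP; right; apply/bigcupP; exists y; rewrite ?inE.
Qed.

End BranchTree.

(** * The four graph classes *)

Definition point_graph : sgraph :=
  @SGraph unit (fun _ _ => false) (fun _ _ => erefl) (fun _ => erefl).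

Lemma point_graph_tree : is_tree point_graph.
Proof.
split; first by split=> [|[] []]; [rewrite card_unit | apply: connect0].
by move=> [|x [|y c]] // _ /andP[/andP[]].
Qed.

(** Serves graphs with at most one vertex, for which [width_le] provides no branch-decomposition. *)
Lemma single_bag_decomposition (G : sgraph) :
  tree_decomposition (fun _ : point_graph => [set: G]).
Proof.
split; [exact: point_graph_tree | by move=> u v _; exists tt; rewrite !inE |].
move=> v; split.
  have tS : (tt : point_graph) \in [set _ : point_graph | v \in [set: G]].
    by rewrite !inE.
  by apply/card_gt0P; exists (exist _ tt tS).
move=> [[] xS] [[] yS]; rewrite (bool_irrelevance xS yS); exact: connect0.
Qed.

Lemma qi_sim_width k : qi_to_bounded_treewidth (fun G => sim_width_le G k).
Proof.
have [q [q_gt0 coarse]] := coarse_treewidth (6 * k).+1 2.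
exists q, (2 * (6 * k).+1); split=> // G.
case=> [G_small|[T [L [[treeT degT L_inj _] widthL]]]].
  apply: coarse (single_bag_decomposition G) _ => _; exists [set: G].
  split=> // [|v _]; first by rewrite cardsT (leq_trans G_small).
  by exists v; rewrite ?inE ?within_refl.
apply: coarse (branch_decomposition_tree L treeT) _ => t.
exact: branch_bag_cover.
Qed.

Lemma qi_tree_independence k : 0 < k ->
  qi_to_bounded_treewidth (fun G => tree_independence_number_le G k).
Proof.
move=> k_gt0; have [q [q_gt0 coarse]] := coarse_treewidth k 1.
exists q, (2 * k); split; rewrite ?muln_gt0 // => G [T [beta [tdG alphaG]]].
apply: coarse tdG _ => t; have [C [CB Ca Cnear]] := alpha_dominating (beta t).
exists C; split=> //; apply: leq_trans Ca (leq_trans _ alphaG).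
exact: (@leq_bigmax _ (fun x => alpha (induced (beta x)))).
Qed.

Lemma width_le_mono (G : sgraph) (f g : {set G} -> nat) k :
  (forall A, f A <= g A) -> width_le g k -> width_le f k.
Proof.
move=> fg [G_small|[T [L [bdL wL]]]]; [by left | right; exists T, L; split=> //].
apply: leq_trans wL; apply/bigmax_leqP => p pT; apply: leq_trans (fg _) _.
exact: (@leq_bigmax_cond _ (fun p : T * T => adj p.1 p.2)
  (fun p => g (branch_side L p.1 p.2))).
Qed.

Lemma qi_to_bounded_treewidth_sub (C C' : sgraph -> Prop) :
  (forall G, C G -> C' G) -> qi_to_bounded_treewidth C' -> qi_to_bounded_treewidth C.
Proof.
by move=> sub [q [w [q0 w0 qiC]]]; exists q, w; split=> // G /sub/qiC.
Qed.

Theorem theorem4 (k : nat) (hk : (0 < k)%N) :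
  [/\ qi_to_bounded_treewidth (fun G : sgraph => rank_width_le G k),
      qi_to_bounded_treewidth (fun G : sgraph => tree_independence_number_le G k),
      qi_to_bounded_treewidth (fun G : sgraph => mim_width_le G k)
    & qi_to_bounded_treewidth (fun G : sgraph => sim_width_le G k)].
Proof.
have sim := qi_sim_width k; split=> //; last 1 first.
- apply: qi_to_bounded_treewidth_sub sim => G; apply: width_le_mono.
  exact: cut_sim_mim.
- apply: qi_to_bounded_treewidth_sub sim => G; apply: width_le_mono.
  exact: cut_sim_rank.
exact: qi_tree_independence.
Qed.
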